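(* Let $p$ be a prime, $n\ge1$, $q=p^n$. Let $L\in\mathbb{F}_q[x]$ be a monic $p$-linearized polynomial that divides $x^q-x$, set $p^{n-k}=\deg(L)$ and $U_L=\{z\in\overline{\mathbb{F}}_q: L(z)=0\}$. Let $f,M\in\mathbb{F}_q[x]$ with $M$ a $p$-linearized polynomial, and let $P(x)=f(L(x))+M(x)\in\mathbb{F}_q[x]$. Then $P$ is a permutation polynomial over $\mathbb{F}_q$ if and only if the following conditions hold: (1) $\gcd(L(x),M(x))=x$ or, equivalently, $M$ restricts to a bijection from $U_L$ to the set $M(U_L)$; (2) the induced map $\varphi:\mathbb{F}_q/U_L\to\mathbb{F}_q/M(U_L)$ given by $\zeta\mapsto P(\zeta)$ (i.e. $\zeta+U_L\mapsto P(\zeta)+M(U_L)$) is a bijection.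
   Context: A $p$-linearized polynomial is a polynomial of the form $\sum_{i=0}^m a_i x^{p^i}$ (the zero polynomial is allowed). $U_L$ is an $\mathbb{F}_p$-subspace of $\mathbb{F}_q$. For $a\in\mathbb{F}_q$ and $u\in U_L$ one has $P(a+u)=P(a)+M(u)$, so $\varphi$ is well defined. A polynomial in $\mathbb{F}_q[x]$ is a permutation polynomial over $\mathbb{F}_q$ if it induces a bijection of $\mathbb{F}_q$. The gcd is monic. *)

(* Defs.v *)
From HB Require Import structures.
From mathcomp Require Import all_boot all_order all_fingroup all_algebra all_field.
Set Implicit Arguments.
Unset Strict Implicit.
Unset Printing Implicit Defensive.
Import GRing.Theory FinRing.Theory.
Local Open Scope ring_scope.

Definition p_linearized (R : nzRingType) (p : nat) (M : {poly R}) : Prop :=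
  exists (m : nat) (a : nat -> R), M = \sum_(i < m.+1) a i *: 'X^(p ^ i).

Definition permutation_poly (F : finFieldType) (P : {poly F}) : Prop :=
  bijective (fun x : F => P.[x]).

(* [gcdp] is only determined up to a nonzero scalar, hence the normalisation. *)
Definition monic_gcdp (F : fieldType) (A B : {poly F}) : {poly F} :=
  (lead_coef (gcdp A B))^-1 *: gcdp A B.

Definition bij_between (T1 T2 : finType) (A : {set T1}) (B : {set T2})
    (f : T1 -> T2) : Prop :=
  [/\ {in A, forall x, f x \in B}, {in A &, injective f}
    & {in B, forall y, exists2 x, x \in A & y = f x}].

Definition closure_roots (F : fieldType) (K : closedFieldType)
    (iota : {rmorphism F -> K}) (L : {poly F}) : {pred K} :=
  root (map_poly iota L).

(* The zero set of [L] in the closure [K] of [F], read inside [F] along the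
   embedding [iota]; by [mem_closure_roots] below no zero is lost when [L]
   divides 'X^#|F| - 'X. *)
Definition UL (F : finFieldType) (K : closedFieldType)
    (iota : {rmorphism F -> K}) (L : {poly F}) : {set F} :=
  [set z | iota z \in closure_roots iota L].

Definition poly_image (F : finFieldType) (M : {poly F}) (A : {set F}) : {set F} :=
  [set M.[z] | z in A].

(* The group law on a finite field is its addition, so that for an additive
   subgroup [A] of [F] the type [coset_of A] is the quotient F/A, and
   [coset A z] is the class z + A. The class [C] is sent to the class of
   [P.[z]] for a representative [z] of [C]; [induced_map_coset] below shows
   that the choice of [z] is irrelevant in the case of interest. For an arbitrary
   set, [coset_of A] is the quotient by the subgroup generated by [A]; see
   [group_set_UL] and [group_set_poly_image]. *)
Definition induced_map (F : finFieldType) (P : {poly F}) (A B : {set F}) :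
    coset_of A -> coset_of B :=
  fun C => coset B P.[repr C].

Section Facts.
Variables (F : finFieldType) (K : closedFieldType) (iota : {rmorphism F -> K}).
Variable p : nat.
Hypothesis pcharF : p \in [pchar F].
Implicit Types (L M f P : {poly F}) (A : {group F}).

Lemma mem_UL L z : (z \in UL iota L) = (L.[z] == 0).
Proof. by rewrite inE -[LHS]/(root _ _) fmorph_root. Qed.

Lemma mem_closure_roots L (w : K) : L %| 'X^#|F| - 'X ->
  w \in closure_roots iota L -> exists2 z, z \in UL iota L & w = iota z.
Proof.
move=> /dvdpP[Q defQ]; rewrite -[_ \in _]/(root _ w) => /rootP Lw0.
have /eqP : (map_poly iota ('X^#|F| - 'X)).[w] = 0.
  by rewrite defQ rmorphM /= hornerM Lw0 mulr0.
rewrite finField_genPoly rmorph_prod /= horner_prod => /prodf_eq0[z _].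
rewrite rmorphB /= map_polyX map_polyC /= -/(root _ _) root_XsubC => /eqP def_w.
by exists z => //; rewrite inE -def_w; apply/rootP.
Qed.

Lemma p_linearizedD M : p_linearized p M -> {morph horner M : x y / x + y}.
Proof.
case=> m [a ->] x y; rewrite !horner_sum -big_split /=; apply: eq_bigr => i _.
rewrite !hornerZ !hornerXn -mulrDr; congr (_ * _).
have pn : [pchar F].-nat (p ^ i)%N.
  by rewrite pnatX (eq_pnat _ (pcharf_eq pcharF)) pnat_id ?(pcharf_prime pcharF).
by rewrite exprDn_pchar.
Qed.

Lemma p_linearized0 M : p_linearized p M -> M.[0] = 0.
Proof.
move=> /p_linearizedD linM.
by apply: (addIr M.[0]); rewrite -linM addr0 add0r.
Qed.

Lemma group_set_UL L : p_linearized p L -> group_set (UL iota L).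
Proof.
move=> linL; apply/group_setP; split=> [|x y].
  by rewrite mem_UL; apply/eqP; apply: p_linearized0 linL.
rewrite !mem_UL => /eqP Lx /eqP Ly.
by rewrite zmodMgE (p_linearizedD linL) Lx Ly addr0.
Qed.

Lemma group_set_poly_image M A : p_linearized p M -> group_set (poly_image M A).
Proof.
move=> linM; apply/group_setP; split=> [|_ _ /imsetP[x Ax ->] /imsetP[y Ay ->]].
  by apply/imsetP; exists 1%g; rewrite ?group1 // (p_linearized0 linM).
apply/imsetP; exists (x * y)%g; first exact: groupM.
by rewrite !zmodMgE (p_linearizedD linM).
Qed.

Lemma induced_map_coset L f M (z : F) :
  p_linearized p L -> p_linearized p M ->
  induced_map (f \Po L + M) (poly_image M (UL iota L)) (coset (UL iota L) z) =
  coset (poly_image M (UL iota L)) (f \Po L + M).[z].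
Proof.
move=> linL linM; rewrite /induced_map.
pose U := group (group_set_UL linL).
pose V := group (group_set_poly_image U linM).
rewrite -[UL iota L]/(gval U) -[poly_image M U]/(gval V).
have inN (A : {group F}) x : x \in ('N(A))%g.
  by apply: (subsetP (sub_abelian_norm (zmod_abelian [set: F]) (subsetT _))).
have : repr (coset U z) \in coset U z by rewrite mem_repr_coset.
rewrite val_coset // => /rcosetP[u Uu ->]; rewrite zmodMgE.
apply/rcoset_kercosetP; rewrite ?inN //.
apply/rcosetP; exists M.[u]; first exact: imset_f.
have /eqP Lu : L.[u] == 0 by rewrite -mem_UL.
by rewrite zmodMgE !hornerD !horner_comp (p_linearizedD linL)
           (p_linearizedD linM) Lu add0r addrCA.
Qed.

End Facts.

(* Main.v *)
Require Import Defs.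
From HB Require Import structures.
From mathcomp Require Import all_boot all_order all_fingroup all_algebra all_field.
Set Implicit Arguments.
Unset Strict Implicit.
Unset Printing Implicit Defensive.
Import GRing.Theory.
Local Open Scope ring_scope.

(** Everything rests on the translation identity P(z + u) = P(z) + M(u) for u
    in U = ker L. It says that P maps the coset z + U onto P(z) + M(U), and does
    so by a shifted copy of M restricted to U. Hence P is a bijection exactly
    when it permutes the cosets bijectively (the induced map) and is injective
    inside each of them (M has no nonzero zero in U); this is
    [bijective_fibration], which uses nothing about polynomials.

    That M has trivial kernel on U is then read in two other ways. By additivity
    it is the injectivity of M on U, i.e. the bijectivity of M from U to M(U).
    And since L divides 'X^q - 'X, which is the product of the distinct linear
    factors 'X - a, the gcd of L and M is up to a scalar the product of the
    'X - a over the common zeros a of L and M in F. As 0 is one of these zeros,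
    the gcd is 'X exactly when it is the only one ([monic_gcdp_eqX]). *)

Lemma coset_zmodP (V : finZmodType) (A : {group V}) (x y : V) :
  reflect (exists2 u, u \in A & x = y + u) (coset A x == coset A y).
Proof.
have inN (z : V) : z \in ('N(A))%g.
  by apply: (subsetP (sub_abelian_norm (FinRing.zmod_abelian [set: V]) (subsetT _))).
apply: (iffP eqP) => [/(rcoset_kercosetP (inN x) (inN y))/rcosetP[u Au ->] | ].
  by exists u; rewrite // FinRing.zmodMgE addrC.
case=> u Au ->; apply/(rcoset_kercosetP (inN _) (inN _))/rcosetP.
by exists u; rewrite // FinRing.zmodMgE addrC.
Qed.

(** The map g is a bijection as soon as it is one on the quotients and on each
    fibre, since m is, up to translation, the restriction of g to any coset
    of A. In the other direction, lifting an equality of images in V/B to V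
    uses that every element of B is m u for some u in A. *)
Lemma bijective_fibration (V : finZmodType) (A B : {group V}) (g m : V -> V)
    (phi : coset_of A -> coset_of B) :
  B = [set m u | u in A] :> {set V} ->
  {in A, forall u z, g (z + u) = g z + m u} ->
  (forall z, phi (coset A z) = coset B (g z)) ->
  bijective g <-> {in A, forall u, m u = 0 -> u = 0} /\ bijective phi.
Proof.
move=> defB gD phiE; split=> [/[dup] bij_g [h hK gK] | [m_ker /bij_inj phi_inj]].
  split=> [u Au mu0 | ].
    by apply/(addrI 0)/(bij_inj bij_g); rewrite gD // mu0 !addr0.
  apply: inj_card_bij => [C D | ].
    have [x _ ->] := cosetP C; have [y _ ->] := cosetP D.
    rewrite !phiE => /eqP/coset_zmodP[v].
    rewrite defB => /imsetP[u Au ->]; rewrite -gD // => /(bij_inj bij_g) ->.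
    by apply/eqP/coset_zmodP; exists u.
  have phi_surj C : C \in codom phi.
    have [y _ ->] := cosetP C.
    by apply/codomP; exists (coset A (h y)); rewrite phiE gK.
  rewrite -[X in (_ <= X)%N](size_image phi).
  by apply: leq_trans (card_size _); apply/subset_leq_card/subsetP.
apply: injF_bij => x y eq_g.
have /eqP/coset_zmodP[u Au def_x] : coset A x = coset A y.
  by apply: phi_inj; rewrite !phiE eq_g.
suff u0 : u = 0 by rewrite def_x u0 addr0.
by apply: m_ker => //; apply: (addrI (g y)); rewrite -gD // -def_x eq_g addr0.
Qed.

Lemma bij_between_poly_image (F : finFieldType) (p : nat) (A : {group F})
    (M : {poly F}) :
  p \in [pchar F] -> p_linearized p M ->
  bij_between A (poly_image M A) (horner M) <->
  {in A, forall u, M.[u] = 0 -> u = 0}.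
Proof.
move=> pcharF linM; have M0 := p_linearized0 pcharF linM.
have MD := p_linearizedD pcharF linM.
split=> [[_ injM _] u Au Mu0 | kerM].
  by apply: injM; rewrite ?Mu0 ?M0 //; exact: (group1 A).
split=> [x Ax | x y Ax Ay eqM | y /imsetP[x Ax ->]]; last by exists x.
  exact: imset_f.
have Axy : x - y \in A.
  by rewrite -FinRing.zmodVgE -FinRing.zmodMgE groupM ?groupV.
apply/subr0_eq/kerM => //; apply: (addIr M.[y]).
by rewrite -MD subrK eqM add0r.
Qed.

(** A divisor of 'X^q - 'X is split with simple roots in F, so the gcd is
    determined by the common zeros. *)
Lemma monic_gcdp_eqX (F : finFieldType) (L M : {poly F}) :
  L %| 'X^#|F| - 'X -> L.[0] = 0 -> M.[0] = 0 ->
  monic_gcdp L M = 'X <-> (forall u, L.[u] = 0 -> M.[u] = 0 -> u = 0).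
Proof.
move=> L_dvd L0 M0; rewrite /monic_gcdp; set g := gcdp L M.
have root_g u : root g u = (L.[u] == 0) && (M.[u] == 0) by rewrite root_gcd.
split=> [gX u Lu Mu | only0].
  have : root g u by rewrite root_g Lu Mu eqxx.
  by move/rootP=> gu; have := hornerX u; rewrite -gX hornerZ gu mulr0.
have g_dvd : g %| \prod_(a <- enum F) ('X - a%:P).
  rewrite big_enum -finField_genPoly.
  exact: dvdp_trans (dvdp_gcdl L M) L_dvd.
have [msk g_eq] := dvdp_prod_XsubC g_dvd.
have s_uniq : uniq (mask msk (enum F)) by rewrite mask_uniq ?enum_uniq.
have mem_s u : (u \in mask msk (enum F)) = root g u.
  by rewrite (eqp_root g_eq) root_prod_XsubC.
have s1 : perm_eq (mask msk (enum F)) [:: 0].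
  apply: uniq_perm => // u; rewrite mem_s root_g inE.
  apply/andP/eqP => [[/eqP Lu /eqP Mu] | ->]; first exact: only0.
  by rewrite L0 M0 eqxx.
have {}g_eq : g %= 'X.
  by move: g_eq; rewrite (perm_big _ s1) big_seq1 subr0.
have g_neq0 : g != 0 by rewrite -size_poly_eq0 (eqp_size g_eq) size_polyX.
apply/eqP; rewrite -eqp_monic ?monicX //.
  by apply: eqp_trans g_eq; rewrite eqp_scale // invr_eq0 lead_coef_eq0.
by rewrite monicE lead_coefZ mulVf ?lead_coef_eq0.
Qed.

Theorem corollary5p3 (p n k : nat) (F : finFieldType)
    (K : closedFieldType) (iota : {rmorphism F -> K}) (L f M P : {poly F})
    (p_prime : prime p) (n_ge1 : (1 <= n)%N) (cardF : #|F| = (p ^ n)%N)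
    (K_algebraic : integralRange iota)
    (L_monic : L \is monic) (L_linearized : p_linearized p L)
    (L_dvd : L %| 'X^(p ^ n) - 'X)
    (k_le_n : (k <= n)%N) (deg_L : (size L).-1 = (p ^ (n - k))%N)
    (M_linearized : p_linearized p M)
    (P_def : P = f \Po L + M) :
  let U := UL iota L in
  let MU := poly_image M U in
  (monic_gcdp L M = 'X <-> bij_between U MU (horner M)) /\
  (permutation_poly P <->
     monic_gcdp L M = 'X /\ bijective (@induced_map F P U MU)).
Proof.
have pcharF : p \in [pchar F] by apply: card_finPcharP cardF p_prime.
pose U := group (group_set_UL iota pcharF L_linearized).
pose MU := group (group_set_poly_image pcharF U M_linearized).
have gcdXP : monic_gcdp L M = 'X <-> {in U, forall u, M.[u] = 0 -> u = 0}.
  have [L0 M0] := (p_linearized0 pcharF L_linearized,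
                   p_linearized0 pcharF M_linearized).
  apply: iff_trans (monic_gcdp_eqX _ L0 M0) _; first by rewrite cardF.
  split=> kerM u; first by rewrite mem_UL => /eqP; apply: kerM.
  by move=> /eqP Lu; apply: kerM; rewrite mem_UL.
have PD : {in U, forall u z, P.[z + u] = P.[z] + M.[u]}.
  move=> u; rewrite mem_UL => /eqP Lu z.
  rewrite P_def !hornerD !horner_comp (p_linearizedD pcharF L_linearized).
  by rewrite (p_linearizedD pcharF M_linearized) Lu addr0 addrA.
have phiE z : @induced_map F P U MU (coset U z) = coset MU P.[z].
  by rewrite P_def; apply: (induced_map_coset iota pcharF).
move=> U' MU'; split.
  apply: iff_trans gcdXP (iff_sym _).
  exact: (bij_between_poly_image U pcharF).
have [fwd bwd] :=
  @bijective_fibration _ U MU (horner P) (horner M) _ (erefl _) PD phiE.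
by split=> [/fwd[/gcdXP] | [/gcdXP kerM bij_phi]] //; apply/bwd.
Qed.
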